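(* Let $m,n$ be integers with $m,n\ge 3$. Then the perfect matching complex $\mathcal{M}_p(H_{1\times m\times n})$ of the honeycomb graph $H_{1\times m\times n}$ is contractible.
   Context: For a finite simple graph $G$, a perfect matching is a set of pairwise vertex-disjoint edges covering every vertex. The perfect matching complex $\mathcal{M}_p(G)$ is the simplicial complex on vertex set $E(G)$ whose faces are the subsets of perfect matchings of $G$. For integers $m,n\ge 1$, the honeycomb graph $H_{1\times m\times n}$ is the planar graph formed by $mn$ hexagonal cells $T_{i,j}$ ($1\le i\le m$, $1\le j\le n$) of the hexagonal lattice arranged as a parallelogram: each hexagon is drawn with a horizontal top and bottom edge; $T_{i,j+1}$ lies directly above $T_{i,j}$ and shares the top edge of $T_{i,j}$; $T_{i+1,j}$ shares the lower-right edge of $T_{i,j}$; and $T_{i+1,j+1}$ shares the upper-right edge of $T_{i,j}$. Its vertices and edges are those of the cells. *)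

(* Defs.v *)
From HB Require Import structures.
From mathcomp Require Import all_boot all_order all_algebra.
From mathcomp Require Import all_classical all_reals topology normedtype.
Import Order.TTheory GRing.Theory Num.Theory numFieldNormedType.Exports.

Set Implicit Arguments.
Unset Strict Implicit.
Unset Printing Implicit Defensive.

Local Open Scope classical_set_scope.
Local Open Scope ring_scope.

Record sgraph := SGraph {
  vertex :> finType;
  adj : rel vertex;
  adj_sym : symmetric adj;
  adj_irrefl : irreflexive adj }.

Definition edge_set (G : sgraph) : {set {set G}} :=
  [set e | [exists u, exists v, adj u v && (e == [set u; v]%SET)]]%SET.

Definition edge (G : sgraph) := {e : {set G} | e \in edge_set G}.

Definition perfect_matching (G : sgraph) (M : {set edge G}) : bool :=
  [forall e in M, forall f in M,
     (e != f) ==> [disjoint (val e : {set G}) & (val f : {set G})]] &&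
  [forall v : G, exists e in M, v \in (val e : {set G})].

Record complex (V : finType) := Complex {
  faces : {set {set V}};
  faces_sub : forall s t : {set V},
    t \subset s -> s \in faces -> t \in faces }.

Definition pm_faces (G : sgraph) : {set {set edge G}} :=
  [set s : {set edge G} | [exists M, perfect_matching M && (s \subset M)]]%SET.

Lemma pm_faces_sub (G : sgraph) (s t : {set edge G}) :
  t \subset s -> s \in pm_faces G -> t \in pm_faces G.
Proof.
rewrite !inE => ts /existsP[M /andP[pM sM]].
by apply/existsP; exists M; rewrite pM (fintype.subset_trans ts sM).
Qed.

Definition perfect_matching_complex (G : sgraph) : complex (edge G) :=
  Complex (@pm_faces_sub G).

(* Points of the realization in barycentric coordinates, inside the product
   R^V. Since V is finite, the topology that R^V induces on this set is the
   usual (weak) topology of the realization. *)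
Definition barycentric (R : realType) (V : finType) (K : complex V) :
    set {ptws V -> R} :=
  [set x | [/\ forall v, 0 <= x v,
               \sum_(v : V) x v = 1 &
               [set v | x v != 0]%SET \in faces K]].
Arguments barycentric R {V} K.

Definition realization (R : realType) (V : finType) (K : complex V) :
  topologicalType := set_type (barycentric R K).
Arguments realization R {V} K.

(* The identity of X is homotopic to a constant map; in particular X is
   nonempty. Only the values of H at times in [0, 1] are relevant. *)
Definition contractible (R : realType) (X : topologicalType) : Prop :=
  exists (a : X) (H : X * R -> X),
    [/\ {within [set: X] `*` `[0, 1], continuous H},
        forall x, H (x, 0) = x &
        forall x, H (x, 1) = a].

(* The lattice is drawn in the affine coordinates (x, y) that stand for the
   point (x / 2, y * sqrt 3 / 2) of the Euclidean plane. The regular hexagon of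
   side 1 with horizontal top and bottom edges centred at the origin then has
   the following corners, listed counterclockwise from the rightmost one. *)
Definition corner_offset (k : 'I_6) : int * int :=
  nth (0, 0) [:: (2, 0); (1, 1); (- 1, 1); (- 2, 0); (- 1, - 1); (1, - 1)] k.

(* The cell T_(i+1, j+1) is centred at (3 i, 2 j - i): going from T_(i, j) to
   T_(i, j+1), T_(i+1, j) and T_(i+1, j+1) translates by (0, 2), (3, -1) and
   (3, 1), that is, across the top, lower-right and upper-right edge. *)
Definition corner (i j : nat) (k : 'I_6) : int * int :=
  (3 * i%:Z + (corner_offset k).1, 2 * j%:Z - i%:Z + (corner_offset k).2).

Definition corners (m n : nat) : seq (int * int) :=
  [seq corner c.1.1 c.1.2 c.2 | c : 'I_m * 'I_n * 'I_6].

Definition honeycomb_vertex (m n : nat) : finType := seq_sub (corners m n).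

(* ordS is the cyclic successor of 'I_6. *)
Definition honeycomb_adj (m n : nat) : rel (honeycomb_vertex m n) :=
  fun u v => [exists i : 'I_m, exists j : 'I_n, exists k : 'I_6,
    ((val u == corner i j k) && (val v == corner i j (ordS k))) ||
    ((val v == corner i j k) && (val u == corner i j (ordS k)))].

Lemma honeycomb_adj_sym (m n : nat) : symmetric (@honeycomb_adj m n).
Proof.
by move=> u v; rewrite /honeycomb_adj; apply: eq_existsb => i;
  apply: eq_existsb => j; apply: eq_existsb => k; rewrite orbC.
Qed.

Lemma corner_ordS (i j : nat) (k : 'I_6) : corner i j k != corner i j (ordS k).
Proof.
rewrite /corner xpair_eqE negb_and !(inj_eq (addrI _)).
by case: k => -[|[|[|[|[|[|//]]]]]] ?.
Qed.

Lemma honeycomb_adj_irrefl (m n : nat) : irreflexive (@honeycomb_adj m n).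
Proof.
move=> u; apply/negbTE/negP; rewrite /honeycomb_adj => /existsP[i] /existsP[j] /existsP[k].
by rewrite orbb => /andP[/eqP->]; apply/negP; exact: corner_ordS.
Qed.

Definition honeycomb (m n : nat) : sgraph :=
  SGraph (@honeycomb_adj_sym m n) (@honeycomb_adj_irrefl m n).

(* Main.v *)
Require Import Defs.
From mathcomp Require Import all_boot all_order all_algebra.
From mathcomp Require Import all_classical all_reals topology normedtype.
From mathcomp Require Import lra zify.
Import Order.TTheory GRing.Theory Num.Theory numFieldNormedType.Exports.

(* Index the edges shared by T_(i, j) and T_(i+1, j+1), including those on the
   boundary, by the points of the grid {0..m} x {0..n} (the points (0, 0) and
   (m, n) carry no edge). A perfect matching is then a monotone lattice path
   from (0, 0) to (m, n): its edges of the two other kinds are the steps of the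
   path, and its grid-point edges are those the path avoids. Each step is
   dominated by a grid point: every path with that step avoids the point.
   Similarly a path that avoids (0, 1) or (0, 2) avoids (0, 3), and a path that
   avoids (1, 0) or (2, 0) avoids (3, 0). So the complex retracts, through a
   contiguous map, to its subcomplex on the grid points other than these four,
   and this subcomplex is a cone with apex (1, 1): a path through (1, 1) can be
   rerouted along (0, 1), (0, 2) or (1, 0), (2, 0) without meeting any further
   remaining point. *)

Set Implicit Arguments.
Unset Strict Implicit.
Unset Printing Implicit Defensive.

(** * Contracting a realization through contiguous maps *)

Section Contraction.
Local Open Scope classical_set_scope.
Local Open Scope ring_scope.
Context (R : realType) (V : finType) (K : complex V) (r : V -> V) (w : V).

(** The two phases of the homotopy: [early] falls from 1 to 0 on the first half of the unit
    interval, [late] rises from 0 to 1 on the second half. Both are clamped because the homotopy has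
    to stay in the realization at every real time. *)
Definition early (t : R) : R := Num.max 0 (Num.min 1 (1 - 2 * t)).
Definition late (t : R) : R := Num.min 1 (Num.max 0 (2 * t - 1)).

Lemma early_late (t : R) :
  [/\ 0 <= early t, 0 <= late t, early t + late t <= 1 &
      early t = 0 \/ late t = 0].
Proof.
rewrite /early /late /Order.max /Order.min.
case: (ltP 1 (1 - 2 * t)) => h1; case: (ltP 0 (2 * t - 1)) => h2;
  do ![case: ltP => ?]; split; lra.
Qed.

Lemma contraction_weights01 :
  [/\ early 0 = 1, late 0 = 0, early 1 = 0 & late 1 = 1].
Proof.
rewrite /early /late mulr0 mulr1 subr0 sub0r; split.
- by rewrite minxx; apply/max_idPr.
- by rewrite (max_idPl _) ?lerN10//; apply/min_idPr.
- by rewrite (min_idPr _) ?(max_idPl _)//; lra.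
- by rewrite (max_idPr _) ?(min_idPl _)//; lra.
Qed.

Lemma continuous_early : continuous early.
Proof.
rewrite /early => t.
apply: (@continuous_max R R (fun=> 0) (fun t => Num.min 1 (1 - 2 * t))).
  exact: cst_continuous.
apply: (@continuous_min R R (fun=> 1) (fun t => 1 - 2 * t)).
  exact: cst_continuous.
apply: cvgB; first exact: cvg_cst.
by apply: cvgM; [exact: cvg_cst | exact: cvg_id].
Qed.

Lemma continuous_late : continuous late.
Proof.
rewrite /late => t.
apply: (@continuous_min R R (fun=> 1) (fun t => Num.max 0 (2 * t - 1))).
  exact: cst_continuous.
apply: (@continuous_max R R (fun=> 0) (fun t => 2 * t - 1)).
  exact: cst_continuous.
apply: cvgB; last exact: cvg_cst.
by apply: cvgM; [exact: cvg_cst | exact: cvg_id].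
Qed.

(* At first the weight [x u] of each vertex [u] moves to [r u], then all the
   weight moves to [w]. *)
Definition contraction (x : V -> R) (t : R) : V -> R := fun v =>
  early t * x v + (1 - early t - late t) * (\sum_(u | r u == v) x u)
  + late t * (v == w)%:R.

(** One of the two weights always vanishes by [early_late]. If [late t = 0], the support lies in the
    union of the old support and its image under [r]; if [early t = 0], it lies in that image
    together with [w]. The two hypotheses make these unions faces. *)
Lemma contraction_barycentric (x : V -> R) (t : R) :
  (forall s : {set V}, s \in faces K ->
     s :|: [set r u | u in s]%SET \in faces K) ->
  (forall s : {set V}, s \in faces K ->
     w |: [set r u | u in s]%SET \in faces K) ->
  barycentric R K x -> barycentric R K (contraction x t).
Proof.
move=> Kr Kw [x_ge0 x_sum x_supp].
have [e0 l0 el1 el] := early_late t.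
split.
- move=> v; rewrite !addr_ge0// mulr_ge0//; first by lra.
  exact: sumr_ge0.
- rewrite /contraction !big_split/= -!mulr_sumr x_sum.
  have -> : \sum_v \sum_(u | r u == v) x u = 1.
    rewrite -x_sum [RHS](partition_big r xpredT)//=.
  have -> : \sum_v (v == w)%:R = 1 :> R.
    by rewrite (bigD1 w)//= eqxx big1 ?addr0// => v /negbTE ->.
  by lra.
set s := [set v | x v != 0]%SET in x_supp.
have supp_r v : \sum_(u | r u == v) x u != 0 -> v \in [set r u | u in s]%SET.
  move=> sum_neq0; have [u /eqP ru xu] : exists2 u, r u == v & x u != 0.
    apply/not_exists2P => h; move/negP: sum_neq0; apply; apply/eqP.
    by apply: big1 => u ru; apply/eqP/negPn/negP; case: (h u).
  by apply/imsetP; exists u; rewrite ?inE.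
case: el => el.
  apply: faces_sub (Kw _ x_supp); apply/fintype.subsetP => v.
  rewrite !inE /contraction.
  rewrite el mul0r add0r; case: (v == w) => //=; rewrite mulr0 addr0.
  by rewrite mulf_eq0 negb_or => /andP[_ /supp_r].
apply: faces_sub (Kr _ x_supp); apply/fintype.subsetP => v.
  rewrite !inE /contraction.
rewrite el mul0r addr0; have [->|//] := eqVneq (x v) 0; rewrite mulr0 add0r.
by rewrite mulf_eq0 negb_or => /andP[_ /supp_r].
Qed.

Lemma continuous_contraction (T : topologicalType) (x : T -> V -> R)
    (t : T -> R) :
  (forall v, continuous (fun z => x z v)) -> continuous t ->
  forall v, continuous (fun z => contraction (x z) (t z) v).
Proof.
move=> cx ct v z.
have ce : early (t z') @[z' --> z] --> early (t z).
  by apply: continuous_comp; [exact: ct | exact: continuous_early].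
have cl : late (t z') @[z' --> z] --> late (t z).
  by apply: continuous_comp; [exact: ct | exact: continuous_late].
apply: cvgD; first apply: cvgD.
- by apply: cvgM => //; exact: cx.
- apply: cvgM.
    by apply: cvgB => //; apply: cvgB => //; exact: cvg_cst.
  apply: cvg_big => [|u _]; [exact: add_continuous | exact: cx].
- by apply: cvgM => //; exact: cvg_cst.
Qed.

(** The last two hypotheses say that [r] is contiguous to the identity and to the constant map at
    [w]. The two linear homotopies are run one after the other. *)
Lemma contractible_realization :
  finset.set0 \in faces K ->
  (forall s : {set V}, s \in faces K ->
     s :|: [set r u | u in s]%SET \in faces K) ->
  (forall s : {set V}, s \in faces K ->
     w |: [set r u | u in s]%SET \in faces K) ->
  contractible R (realization R K).
Proof.
move=> K0 Kr Kw.
pose dw : V -> R := fun v => (v == w)%:R.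
have dwP : dw \in barycentric R K.
  apply/mem_set; split.
  - by move=> v; rewrite /dw ler0n.
  - by rewrite /dw (bigD1 w)//= eqxx big1 ?addr0// => v /negbTE ->.
  (* Applied to the empty face, [Kw] shows that [w] is a vertex of the complex, so the end point is
     in the realization. *)
  - apply: faces_sub (Kw _ K0); apply/fintype.subsetP => v; rewrite !inE /dw.
    by case: (v == w) => //; rewrite eqxx.
have HP (z : realization R K * R) :
    contraction (val z.1) z.2 \in barycentric R K.
  by apply/mem_set/contraction_barycentric => //; exact: set_valP.
pose H (z : realization R K * R) : realization R K := SigSub (HP z).
exists (SigSub dwP), H; split.
- apply: continuous_subspaceT.
  (* The topology is induced from the product, so continuity is checked coordinate by coordinate. *)
  apply: continuous_comp_initial.
  move=> z; apply/cvg_sup => v; move: z.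
  apply: (@continuous_comp_initial _ _ _ (fun f : V -> R => f v)).
  apply: continuous_contraction => [u z|z]; last exact: cvg_snd.
  apply: (@continuous_comp _ _ _ (fst : realization R K * R -> _)
    (fun y : realization R K => set_val y u)).
    exact: cvg_fst.
  apply: (@continuous_comp _ {ptws V -> R} R set_val
    (fun f : {ptws V -> R} => f u)).
    exact: initial_continuous.
  exact: (@proj_continuous V (fun=> R) u).
- move=> x; apply: val_inj; apply/funext => v /=.
  have [e0 l0 _ _] := contraction_weights01.
  by rewrite /contraction e0 l0 subrr subr0 !mul0r !addr0 mul1r.
- move=> x; apply: val_inj; apply/funext => v /=.
  have [_ _ e1 l1] := contraction_weights01.
  by rewrite /contraction e1 l1 subr0 subrr !mul0r !add0r mul1r.
Qed.

End Contraction.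

(** * Perfect matchings and alternating hexagons *)

Section PerfectMatching.
Context (G : sgraph).
Implicit Types (M : {set edge G}) (e f : edge G) (v : G).

Lemma perfect_matchingP M : reflect
  ((forall e f v, e \in M -> f \in M -> v \in val e -> v \in val f -> e = f) /\
   (forall v, exists2 e, e \in M & v \in val e))
  (perfect_matching M).
Proof.
apply: (iffP andP) => [[disj cov]|[inj cov]]; split.
- move=> e f v eM fM ve vf; apply/eqP/negPn/negP => ef.
  move/forall_inP/(_ e eM)/forall_inP/(_ f fM): disj; rewrite ef /=.
  by move/pred0P/(_ v) => /=; rewrite ve vf.
- by move=> v; move/forallP/(_ v)/exists_inP: cov.
- apply/forall_inP => e eM; apply/forall_inP => f fM; apply/implyP => ef.
  apply/pred0P => v /=; apply/negP => /andP[ve vf].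
  by rewrite (inj _ _ _ eM fM ve vf) eqxx in ef.
- by apply/forallP => v; apply/exists_inP; exact: cov.
Qed.

(** The two triples of alternate sides cover the same six vertices, so one triple can replace the
    other in a matching. *)
Lemma flip_hexagon M (a b c d e f : G) (ab bc cd de ef fa : edge G) :
  perfect_matching M -> uniq [:: a; b; c; d; e; f] ->
  val ab = [set a; b]%SET -> val bc = [set b; c]%SET ->
  val cd = [set c; d]%SET -> val de = [set d; e]%SET ->
  val ef = [set e; f]%SET -> val fa = [set f; a]%SET ->
  ab \in M -> cd \in M -> ef \in M ->
  exists M', [/\ perfect_matching M', [/\ bc \in M', de \in M' & fa \in M'] &
    forall g, g \in M -> g <> ab -> g <> cd -> g <> ef -> g \in M'].
Proof.
move=> /perfect_matchingP[inj cov] abcdef abE bcE cdE deE efE faE abM cdM efM.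
have oldP v : (v \in [:: a; b; c; d; e; f]) =
    [|| v \in val ab, v \in val cd | v \in val ef].
  by rewrite abE cdE efE !inE !orbA.
have newP v : (v \in [:: a; b; c; d; e; f]) =
    [|| v \in val bc, v \in val de | v \in val fa].
  rewrite bcE deE faE !inE; do ![case: (v == _) => //].
have new_inj g h v : g \in [set bc; de; fa]%SET -> h \in [set bc; de; fa]%SET ->
    v \in val g -> v \in val h -> g = h.
  move: abcdef; rewrite /= !inE !negb_or.
  rewrite -!andbA => uq.
  move=> /orP[/orP[]|] /eqP-> /orP[/orP[]|] /eqP-> //;
  rewrite ?bcE ?deE ?faE !inE => /orP[] /eqP-> /orP[] /eqP E;
  by move: uq; rewrite E eqxx ?andbF.
(* A kept edge touching the hexagon would share a vertex with a removed edge, hence be equal to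
   it. *)
have old_new g h v : g \in M -> g \notin [set ab; cd; ef]%SET ->
    h \in [set bc; de; fa]%SET -> v \in val g -> v \in val h -> False.
  move=> gM gold hnew vg vh; move/negP: gold; apply.
  have : v \in [:: a; b; c; d; e; f].
    by rewrite newP; move: hnew; rewrite !inE => /orP[/orP[]|] /eqP<-;
      rewrite vh ?orbT.
  by rewrite oldP !inE => /or3P[] vo; [rewrite (inj _ _ _ gM abM vg vo)
    |rewrite (inj _ _ _ gM cdM vg vo)|rewrite (inj _ _ _ gM efM vg vo)];
    rewrite eqxx ?orbT.
exists ((M :\: [set ab; cd; ef]) :|: [set bc; de; fa])%SET; split; last 2 first.
- by split; rewrite !inE eqxx ?orbT.
- move=> g gM /eqP gab /eqP gcd /eqP gef; rewrite !inE gM.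
  by rewrite (negbTE gab) (negbTE gcd) (negbTE gef).
apply/perfect_matchingP; split=> [g h v|v].
  rewrite (finset.in_setU g) (finset.in_setU h) !finset.in_setD.
  move=> /orP[/andP[gold gM]|gnew] /orP[/andP[hold hM]|hnew] vg vh.
  - exact: (inj _ _ _ gM hM vg vh).
  - by case: (old_new _ _ _ gM gold hnew vg vh).
  - by case: (old_new _ _ _ hM hold gnew vh vg).
  - exact: (new_inj _ _ _ gnew hnew vg vh).
have [vhex|vhex] := boolP (v \in [:: a; b; c; d; e; f]).
  move: vhex; rewrite newP => /or3P[] ?; [exists bc|exists de|exists fa] => //;
  by rewrite !inE eqxx ?orbT.
have [g gM vg] := cov v; exists g => //; rewrite !inE gM andbT.
apply/orP; left; apply: contra vhex; rewrite oldP => /orP[/orP[]|] /eqP<-;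
by rewrite vg ?orbT.
Qed.

End PerfectMatching.

(** * Vertices of the honeycomb in grid coordinates *)

Section Coordinates.
Local Open Scope nat_scope.
Context (m n : nat) (m_gt0 : 0 < m) (n_gt0 : 0 < n).

(* The ends of the edge that T_(p, n - q) shares with T_(p+1, n - q + 1). *)
Definition xpt (p q : nat) : int * int :=
  (3 * p%:Z - 2, 2 * n%:Z - 2 * q%:Z - p%:Z)%R.
Definition ypt (p q : nat) : int * int :=
  (3 * p%:Z - 1, 2 * n%:Z - 2 * q%:Z - p%:Z - 1)%R.

(* The corners of T_(p + 1, n - q), in the order of [corner]. *)
Definition cell_pts (p q : nat) : seq (int * int) :=
  [:: ypt p.+1 q; xpt p.+1 q; ypt p q; xpt p q.+1; ypt p q.+1; xpt p.+1 q.+1].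

(** The index [j] of [corner] starts from 0 at the bottom, while [q] counts downwards from the top;
    this reversal makes both kinds of step increase a coordinate. *)
Lemma corner_cell_pts (p q : nat) (k : 'I_6) :
  q < n -> corner p (n - q.+1) k = nth (0, 0)%R (cell_pts p q) k.
Proof.
move=> qn; case: k => -[|[|[|[|[|[|//]]]]]] i /=;
  rewrite /corner /corner_offset /=; apply/eqP; rewrite xpair_eqE;
  apply/andP; split; apply/eqP; lia.
Qed.

Lemma mem_corners (p q : nat) (k : 'I_6) :
  p < m -> q < n -> nth (0, 0)%R (cell_pts p q) k \in corners m n.
Proof.
move=> pm qn; rewrite -corner_cell_pts//.
have jn : n - q.+1 < n by lia.
by apply/fintype.imageP; exists (Ordinal pm, Ordinal jn, k).
Qed.

Lemma cornersP (z : int * int) : z \in corners m n ->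
  exists p q (k : 'I_6), [/\ p < m, q < n & z = nth (0, 0)%R (cell_pts p q) k].
Proof.
move=> /fintype.imageP[[[i j] k] _ ->]/=; exists i, (n - j.+1), k.
have jn := ltn_ord j; have im := ltn_ord i; split=> //; first by lia.
rewrite -corner_cell_pts; last by lia.
by congr (corner i _ k); lia.
Qed.

Local Notation G := (honeycomb m n).

Lemma adj_cell_pts (u v : G) (p q : nat) (k : 'I_6) :
  p < m -> q < n -> val u = nth (0, 0)%R (cell_pts p q) k ->
  val v = nth (0, 0)%R (cell_pts p q) (ordS k) -> adj u v.
Proof.
move=> pm qn uE vE; have jn : n - q.+1 < n by lia.
apply/existsP; exists (Ordinal pm); apply/existsP; exists (Ordinal jn).
by apply/existsP; exists k; rewrite /= !corner_cell_pts// uE vE !eqxx.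
Qed.

Lemma adj_cell_ptsP (u v : G) : adj u v ->
  exists p q (k : 'I_6), [/\ p < m, q < n &
    val u = nth (0, 0)%R (cell_pts p q) k /\
      val v = nth (0, 0)%R (cell_pts p q) (ordS k) \/
    val v = nth (0, 0)%R (cell_pts p q) k /\
      val u = nth (0, 0)%R (cell_pts p q) (ordS k)].
Proof.
case/existsP=> i /existsP[j] /existsP[k] h; exists i, (n - j.+1), k.
have jn := ltn_ord j; have im := ltn_ord i; split=> //; first by lia.
have qn : n - j.+1 < n by lia.
rewrite -!(corner_cell_pts _ _ qn).
have -> : n - (n - j.+1).+1 = j by lia.
by case/orP: h => /andP[/eqP-> /eqP->]; [left|right].
Qed.

(** This vertex serves as the default value of [xv] and [yv], for instance of [xv 0 0] and [yv m n],
    where the grid point has no such end. *)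
Lemma root_subproof : nth (0, 0)%R (cell_pts 0 0) (@ord0 5) \in corners m n.
Proof. exact: mem_corners. Qed.

Definition xv (p q : nat) : G := insubd (SeqSub root_subproof) (xpt p q).
Definition yv (p q : nat) : G := insubd (SeqSub root_subproof) (ypt p q).

Lemma val_xv (p q : nat) :
  p <= m -> q <= n -> 0 < p + q -> val (xv p q) = xpt p q.
Proof.
move=> pm qn pq; rewrite val_insubd ifT//.
(* The point can be a corner of three cells; one that exists is selected by the sides of the grid
   that contain [(p, q)]. *)
have [p0|p0] := posnP p.
  have := @mem_corners p q.-1 (inord 3); rewrite inordK//=.
  by rewrite prednK; [apply; lia | lia].
have [qn'|qn'] := ltnP q n.
  by have := @mem_corners p.-1 q (inord 1);
    rewrite inordK//= prednK//; apply; lia.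
have := @mem_corners p.-1 q.-1 (inord 5);
  rewrite inordK//= !prednK//; [apply|]; lia.
Qed.

Lemma val_yv (p q : nat) :
  p <= m -> q <= n -> p + q < m + n -> val (yv p q) = ypt p q.
Proof.
move=> pm qn pq; rewrite val_insubd ifT//.
have [p0|p0] := ltnP p m; last first.
  have := @mem_corners p.-1 q (inord 0);
    rewrite inordK//= prednK; [apply|]; lia.
have [qn'|qn'] := ltnP q n.
  by have := @mem_corners p q (inord 2); rewrite inordK//=; apply; lia.
have := @mem_corners p q.-1 (inord 4);
  rewrite inordK//= !prednK//; [apply|]; lia.
Qed.

Lemma vertexP (v : G) :
  (exists p q, [/\ p <= m, q <= n, 0 < p + q & v = xv p q]) \/
  (exists p q, [/\ p <= m, q <= n, p + q < m + n & v = yv p q]).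
Proof.
have [p [q [k [pm qn vE]]]] := cornersP (valP v).
have xE p' q' : p' <= m -> q' <= n -> 0 < p' + q' -> val v = xpt p' q' ->
    exists p q, [/\ p <= m, q <= n, 0 < p + q & v = xv p q].
  move=> *; exists p', q'; split=> //; apply: val_inj; rewrite val_xv//.
have yE p' q' : p' <= m -> q' <= n -> p' + q' < m + n -> val v = ypt p' q' ->
    exists p q, [/\ p <= m, q <= n, p + q < m + n & v = yv p q].
  move=> *; exists p', q'; split=> //; apply: val_inj; rewrite val_yv//.
case: k vE => -[|[|[|[|[|[|//]]]]]] ? /= vE;
  first [by right; apply: yE vE; lia | by left; apply: xE vE; lia].
Qed.

Lemma xv_inj (p q p' q' : nat) :
  p <= m -> q <= n -> 0 < p + q -> p' <= m -> q' <= n -> 0 < p' + q' ->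
  xv p q = xv p' q' -> p = p' /\ q = q'.
Proof.
by move=> ? ? ? ? ? ? /(congr1 val); rewrite !val_xv// => -[] *; lia.
Qed.

Lemma yv_inj (p q p' q' : nat) :
  p <= m -> q <= n -> p + q < m + n -> p' <= m -> q' <= n -> p' + q' < m + n ->
  yv p q = yv p' q' -> p = p' /\ q = q'.
Proof.
by move=> ? ? ? ? ? ? /(congr1 val); rewrite !val_yv// => -[] *; lia.
Qed.

Lemma xv_neq_yv (p q p' q' : nat) :
  p <= m -> q <= n -> 0 < p + q -> p' <= m -> q' <= n -> p' + q' < m + n ->
  xv p q <> yv p' q'.
Proof.
by move=> ? ? ? ? ? ? /(congr1 val); rewrite val_xv// val_yv// => -[] *; lia.
Qed.

(** * Edges of the honeycomb in grid coordinates *)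

Lemma adj_rung (p q : nat) :
  p <= m -> q <= n -> 0 < p + q < m + n -> adj (xv p q) (yv p q).
Proof.
move=> pm qn /andP[pq0 pq1].
(* The two possible cells are those with indices [(p - 1, q)] and [(p, q - 1)]. If the first is
   missing, then [p < m] and [0 < q], so the second exists. *)
have [/andP[p0 qn']|h] := boolP ((0 < p) && (q < n)).
  rewrite adj_sym; apply: (@adj_cell_pts _ _ p.-1 q (inord 0));
    first lia; first lia.
    by rewrite val_yv// inordK//= prednK.
  by rewrite val_xv//= inordK//= prednK.
apply: (@adj_cell_pts _ _ p q.-1 (inord 3)); first lia; first lia.
  by rewrite val_xv// inordK//= prednK//; lia.
by rewrite val_yv//= inordK//= prednK//; lia.
Qed.

Lemma adj_right (p q : nat) : p < m -> q <= n -> adj (yv p q) (xv p.+1 q).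
Proof.
move=> pm qn; have [qn'|qn'] := ltnP q n.
  rewrite adj_sym; apply: (@adj_cell_pts _ _ p q (inord 1)) => //.
    by rewrite val_xv ?inordK//; lia.
  by rewrite val_yv /= ?inordK//; lia.
apply: (@adj_cell_pts _ _ p q.-1 (inord 4)) => //; first lia.
  by rewrite val_yv ?inordK//= ?prednK//; lia.
by rewrite val_xv /= ?inordK//= ?prednK//; lia.
Qed.

Lemma adj_up (p q : nat) : p <= m -> q < n -> adj (yv p q) (xv p q.+1).
Proof.
move=> pm qn; have [pm'|pm'] := ltnP p m.
  apply: (@adj_cell_pts _ _ p q (inord 2)) => //.
    by rewrite val_yv ?inordK//; lia.
  by rewrite val_xv /= ?inordK//; lia.
rewrite adj_sym; apply: (@adj_cell_pts _ _ p.-1 q (inord 5)) => //; first lia.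
  by rewrite val_xv ?inordK//= ?prednK//; lia.
by rewrite val_yv /= ?inordK//= ?prednK//; lia.
Qed.

Lemma adj_step (d : bool) (p q : nat) :
  p + d <= m -> q + ~~ d <= n -> adj (yv p q) (xv (p + d) (q + ~~ d)).
Proof.
case: d; rewrite ?addn0 ?addn1; [exact: adj_right | exact: adj_up].
Qed.

Lemma edge_subproof (u v : G) : adj u v -> [set u; v]%SET \in edge_set G.
Proof.
move=> uv; rewrite inE; apply/existsP; exists u; apply/existsP; exists v.
by rewrite uv eqxx.
Qed.

(** An edge that exists in every honeycomb with [m] and [n] positive, used as the default of
    [mkedge]. *)
Lemma base_edge_subproof : [set xv 0 1; yv 0 1]%SET \in edge_set G.
Proof. by apply: edge_subproof; apply: adj_rung => //; lia. Qed.

Definition mkedge (u v : G) : edge G :=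
  insubd (exist (fun e => e \in edge_set G) _ base_edge_subproof : edge G)
    ([set u; v]%SET : {set G}).

(* [rung p q] is the edge indexed by the grid point [(p, q)]; [step d p q] is
   the step of lattice paths from there to [(p + 1, q)] or [(p, q + 1)]. Both
   are junk for indices out of bounds. *)
Definition rung (p q : nat) := mkedge (xv p q) (yv p q).
Definition step (d : bool) (p q : nat) :=
  mkedge (yv p q) (xv (p + d) (q + ~~ d)).

Lemma val_mkedge (u v : G) : adj u v -> val (mkedge u v) = [set u; v]%SET.
Proof. by move=> uv; rewrite val_insubd edge_subproof. Qed.

Lemma val_rung (p q : nat) : p <= m -> q <= n -> 0 < p + q < m + n ->
  val (rung p q) = [set xv p q; yv p q]%SET.
Proof. by move=> *; apply: val_mkedge; exact: adj_rung. Qed.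

Lemma val_step (d : bool) (p q : nat) : p + d <= m -> q + ~~ d <= n ->
  val (step d p q) = [set yv p q; xv (p + d) (q + ~~ d)]%SET.
Proof. by move=> *; apply: val_mkedge; exact: adj_step. Qed.

(** Counterclockwise from the rightmost corner, the sides of a cell are the rung at [(p + 1, q)],
    the two steps out of [(p, q)], the rung at [(p, q + 1)] and the two steps into
    [(p + 1, q + 1)]. *)
Lemma edgeP (e : edge G) :
  (exists p q, [/\ p <= m, q <= n, 0 < p + q < m + n & e = rung p q]) \/
  (exists (d : bool) p q, [/\ p + d <= m, q + ~~ d <= n & e = step d p q]).
Proof.
have := valP e; rewrite inE => /existsP[u /existsP[v /andP[uv /eqP eE]]].
have {uv} : exists p q (k : 'I_6), [/\ p < m, q < n & exists u v : G,
    [/\ val e = [set u; v]%SET, val u = nth (0, 0)%R (cell_pts p q) k &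
    val v = nth (0, 0)%R (cell_pts p q) (ordS k)]].
  have [p [q [k [pm qn [[uE vE]|[uE vE]]]]]] := adj_cell_ptsP uv.
    by exists p, q, k; split=> //; exists u, v.
  by exists p, q, k; split=> //; exists v, u; rewrite finset.setUC.
move=> {u v eE} [p [q [k [pm qn [u [v [eE uE vE]]]]]]].
have isrung p' q' : p' <= m -> q' <= n -> 0 < p' + q' < m + n ->
    [set u; v]%SET = [set xv p' q'; yv p' q']%SET ->
    exists p q, [/\ p <= m, q <= n, 0 < p + q < m + n & e = rung p q].
  move=> *; exists p', q'; split=> //; apply: val_inj.
  by rewrite eE val_rung.
have isstep (d : bool) p' q' : p' + d <= m -> q' + ~~ d <= n ->
    [set u; v]%SET = [set yv p' q'; xv (p' + d) (q' + ~~ d)]%SET ->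
    exists (d : bool) p q, [/\ p + d <= m, q + ~~ d <= n & e = step d p q].
  move=> *; exists d, p', q'; split=> //; apply: val_inj.
  by rewrite eE val_step.
have ux p' q' : p' <= m -> q' <= n -> 0 < p' + q' -> val u = xpt p' q' ->
  u = xv p' q' by move=> *; apply: val_inj; rewrite val_xv.
have uy p' q' : p' <= m -> q' <= n -> p' + q' < m + n -> val u = ypt p' q' ->
  u = yv p' q' by move=> *; apply: val_inj; rewrite val_yv.
have vx p' q' : p' <= m -> q' <= n -> 0 < p' + q' -> val v = xpt p' q' ->
  v = xv p' q' by move=> *; apply: val_inj; rewrite val_xv.
have vy p' q' : p' <= m -> q' <= n -> p' + q' < m + n -> val v = ypt p' q' ->
  v = yv p' q' by move=> *; apply: val_inj; rewrite val_yv.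
case: k uE vE => -[|[|[|[|[|[|//]]]]]] ? /= uE vE.
- left; apply: (isrung p.+1 q); [lia|lia|lia|].
  by rewrite (uy _ _ _ _ _ uE) ?(vx _ _ _ _ _ vE) 1?finset.setUC//; lia.
- right; apply: (isstep true p q); [lia|lia|].
  rewrite (ux _ _ _ _ _ uE) ?(vy _ _ _ _ _ vE); try lia.
  by rewrite 1?finset.setUC ?addn1 ?addn0.
- right; apply: (isstep false p q); [lia|lia|].
  by rewrite (uy _ _ _ _ _ uE) ?(vx _ _ _ _ _ vE) ?addn1 ?addn0//; lia.
- left; apply: (isrung p q.+1); [lia|lia|lia|].
  by rewrite (ux _ _ _ _ _ uE) ?(vy _ _ _ _ _ vE)//; lia.
- right; apply: (isstep true p q.+1); [lia|lia|].
  by rewrite (uy _ _ _ _ _ uE) ?(vx _ _ _ _ _ vE) ?addn1 ?addn0//; lia.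
- right; apply: (isstep false p.+1 q); [lia|lia|].
  rewrite (ux _ _ _ _ _ uE) ?(vy _ _ _ _ _ vE); try lia.
  by rewrite 1?finset.setUC ?addn1 ?addn0.
Qed.

(** * Incidences between vertices and edges *)

Lemma xv_rung (p q : nat) : p <= m -> q <= n -> 0 < p + q < m + n ->
  xv p q \in val (rung p q).
Proof. by move=> *; rewrite val_rung// !inE eqxx. Qed.

Lemma yv_rung (p q : nat) : p <= m -> q <= n -> 0 < p + q < m + n ->
  yv p q \in val (rung p q).
Proof. by move=> *; rewrite val_rung// !inE eqxx orbT. Qed.

Lemma yv_step (d : bool) (p q : nat) : p + d <= m -> q + ~~ d <= n ->
  yv p q \in val (step d p q).
Proof. by move=> *; rewrite val_step// !inE eqxx. Qed.

Lemma xv_step (d : bool) (p q : nat) : p + d <= m -> q + ~~ d <= n ->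
  xv (p + d) (q + ~~ d) \in val (step d p q).
Proof. by move=> *; rewrite val_step// !inE eqxx orbT. Qed.

(** Steps enter a grid point at its [xv] end and, by [yv_in_edge], leave it at its [yv] end. This is
    what directs the path of a matching. *)
Lemma xv_in_edge (e : edge G) (p q : nat) :
  p <= m -> q <= n -> 0 < p + q -> xv p q \in val e ->
  (p + q < m + n /\ e = rung p q) \/
  (exists (d : bool) p' q', [/\ p = p' + d, q = q' + ~~ d & e = step d p' q']).
Proof.
move=> pm qn pq; case: (edgeP e) => [[p' [q' [pm' qn' pq' ->]]]|].
  rewrite val_rung// !inE => /orP[]/eqP E; last first.
    by case: (xv_neq_yv pm qn pq pm' qn' _ E); lia.
  have [-> ->] : p = p' /\ q = q' by apply: xv_inj E => //; lia.
  by left; split=> //; lia.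
case=> d [p' [q' [pm' qn' ->]]]; rewrite val_step// !inE => /orP[]/eqP E.
  by case: (xv_neq_yv pm qn pq _ _ _ E); lia.
have [-> ->] : p = p' + d /\ q = q' + ~~ d by apply: xv_inj E => //; lia.
by right; exists d, p', q'.
Qed.

Lemma yv_in_edge (e : edge G) (p q : nat) :
  p <= m -> q <= n -> p + q < m + n -> yv p q \in val e ->
  (0 < p + q /\ e = rung p q) \/
  (exists d : bool, [/\ p + d <= m, q + ~~ d <= n & e = step d p q]).
Proof.
move=> pm qn pq; case: (edgeP e) => [[p' [q' [pm' qn' pq' ->]]]|].
  rewrite val_rung// !inE => /orP[]/eqP E.
    by case: (xv_neq_yv pm' qn' _ pm qn pq (esym E)); lia.
  have [-> ->] : p = p' /\ q = q' by apply: yv_inj E => //; lia.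
  by left; split=> //; lia.
case=> d [p' [q' [pm' qn' ->]]]; rewrite val_step// !inE => /orP[]/eqP E.
  have [-> ->] : p = p' /\ q = q' by apply: yv_inj E => //; lia.
  by right; exists d.
by case: (xv_neq_yv pm' qn' _ pm qn pq (esym E)); lia.
Qed.

Lemma step_inj (d d' : bool) (p q p' q' : nat) :
  p + d <= m -> q + ~~ d <= n -> p' + d' <= m -> q' + ~~ d' <= n ->
  step d p q = step d' p' q' -> [/\ d = d', p = p' & q = q'].
Proof.
move=> pm qn pm' qn' E.
have := yv_step pm qn; rewrite E val_step// !inE => /orP[]/eqP Ey; last first.
  by case: (@xv_neq_yv (p' + d') (q' + ~~ d') p q _ _ _ _ _ _ (esym Ey)); lia.
have [pp' qq'] : p = p' /\ q = q' by apply: yv_inj Ey; lia.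
have := xv_step pm qn; rewrite E val_step// !inE => /orP[]/eqP Ex.
  by case: (@xv_neq_yv (p + d) (q + ~~ d) p' q' _ _ _ _ _ _ Ex); lia.
have : p + d = p' + d' /\ q + ~~ d = q' + ~~ d' by apply: xv_inj Ex; lia.
by split=> //; lia.
Qed.

Lemma rung_neq_step (d : bool) (p q p' q' : nat) :
  p <= m -> q <= n -> 0 < p + q < m + n -> p' + d <= m -> q' + ~~ d <= n ->
  rung p q <> step d p' q'.
Proof.
move=> pm qn pq pm' qn' E.
have := xv_rung pm qn pq; rewrite E val_step// !inE => /orP[]/eqP Ex.
  by case: (@xv_neq_yv p q p' q' _ _ _ _ _ _ Ex); lia.
have := yv_rung pm qn pq; rewrite E val_step// !inE => /orP[]/eqP Ey; last first.
  by case: (@xv_neq_yv (p' + d) (q' + ~~ d) p q _ _ _ _ _ _ (esym Ey)); lia.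
have : p = p' + d /\ q = q' + ~~ d by apply: xv_inj Ex; lia.
have : p = p' /\ q = q' by apply: yv_inj Ey; lia.
lia.
Qed.

Lemma step_level (d : bool) (p q : nat) : p + d + (q + ~~ d) = (p + q).+1.
Proof. by case: d; rewrite addn0 addn1 ?addnS ?addSn. Qed.

(** * A perfect matching as a lattice path *)

Section Matching.
Context (M : {set edge G}) (pM : perfect_matching M).

Lemma matching_eq (e f : edge G) (v : G) :
  e \in M -> f \in M -> v \in val e -> v \in val f -> e = f.
Proof. by case/perfect_matchingP: pM => inj _; exact: inj. Qed.

(** In terms of paths, a point is either avoided or entered by a step; [cover_yv] is the counterpart
    for leaving it. *)
Lemma cover_xv (p q : nat) : p <= m -> q <= n -> 0 < p + q ->
  (p + q < m + n /\ rung p q \in M) \/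
  (exists (d : bool) p' q',
    [/\ p = p' + d, q = q' + ~~ d & step d p' q' \in M]).
Proof.
move=> pm qn pq; case/perfect_matchingP: pM => _ /(_ (xv p q))[e eM].
case/(xv_in_edge pm qn pq) => [[pq1 eE]|[d [p' [q' [pE qE eE]]]]].
  by left; rewrite -eE.
by right; exists d, p', q'; rewrite -eE.
Qed.

Lemma cover_yv (p q : nat) : p <= m -> q <= n -> p + q < m + n ->
  (0 < p + q /\ rung p q \in M) \/
  (exists d : bool, [/\ p + d <= m, q + ~~ d <= n & step d p q \in M]).
Proof.
move=> pm qn pq; case/perfect_matchingP: pM => _ /(_ (yv p q))[e eM].
case/(yv_in_edge pm qn pq) => [[pq1 eE]|[d [pE qE eE]]].
  by left; rewrite -eE.
by right; exists d; rewrite -eE.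
Qed.

(** Both edges contain [yv p q]: a path does not leave a point that it avoids. *)
Lemma rung_step_source (d : bool) (p q : nat) :
  p + d <= m -> q + ~~ d <= n -> 0 < p + q ->
  rung p q \in M -> step d p q \in M -> False.
Proof.
move=> pm qn pq rM sM.
have [? ? ?] : [/\ p <= m, q <= n & 0 < p + q < m + n] by split; lia.
apply: (@rung_neq_step d p q p q) => //; apply: (matching_eq rM sM).
  exact: yv_rung.
exact: yv_step.
Qed.

(* A step at a positive level forces one at the previous level, and all lattice
   paths start at [(0, 0)]. *)
Lemma step_level_inj (d d' : bool) (p q p' q' : nat) :
  p + d <= m -> q + ~~ d <= n -> p' + d' <= m -> q' + ~~ d' <= n ->
  step d p q \in M -> step d' p' q' \in M -> p + q = p' + q' ->
  [/\ d = d', p = p' & q = q'].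
Proof.
have incoming (d0 : bool) p0 q0 : p0 + d0 <= m -> q0 + ~~ d0 <= n ->
    0 < p0 + q0 -> step d0 p0 q0 \in M -> exists (d1 : bool) p1 q1,
    [/\ p0 = p1 + d1, q0 = q1 + ~~ d1 & step d1 p1 q1 \in M].
  move=> pm0 qn0 pq0 sM0; have [pm1 qn1] : p0 <= m /\ q0 <= n by lia.
  case: (cover_xv pm1 qn1 pq0) => // -[_ rM].
  by case: (rung_step_source pm0 qn0 pq0 rM sM0).
have same_source (d1 d2 : bool) p1 q1 : p1 + d1 <= m -> q1 + ~~ d1 <= n ->
    p1 + d2 <= m -> q1 + ~~ d2 <= n -> step d1 p1 q1 \in M ->
    step d2 p1 q1 \in M -> d1 = d2.
  move=> pm1 qn1 pm2 qn2 sM1 sM2.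
  have E := matching_eq sM1 sM2 (yv_step pm1 qn1) (yv_step pm2 qn2).
  by case: (step_inj pm1 qn1 pm2 qn2 E).
move=> pm qn pm' qn' sM sM' pq'; suff pq_eq : p = p' /\ q = q'.
  case: pq_eq => pE qE; split=> //; move: sM' pm' qn'; rewrite -pE -qE => *.
  exact: same_source sM _.
have {pq'} : p + q = p + q /\ p' + q' = p + q by rewrite pq'.
(* Only the two right-hand sides are generalized, so that the induction is on the common level while
   the points vary. *)
move: {2 3}(p + q) => k.
elim: k => [|k IHk] in d d' p q p' q' pm qn pm' qn' sM sM' * => -[pqk pqk'].
  by lia.
have [pq0 pq0'] : 0 < p + q /\ 0 < p' + q' by rewrite pqk pqk'.
have [d1 [p1 [q1 [pE qE sM1]]]] := incoming d p q pm qn pq0 sM.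
have [d2 [p2 [q2 [pE' qE' sM2]]]] := incoming d' p' q' pm' qn' pq0' sM'.
have [pm1 qn1] : p1 + d1 <= m /\ q1 + ~~ d1 <= n.
  by rewrite -pE -qE (leq_trans (leq_addr d p) pm)
    (leq_trans (leq_addr (~~ d) q) qn).
have [pm2 qn2] : p2 + d2 <= m /\ q2 + ~~ d2 <= n.
  by rewrite -pE' -qE' (leq_trans (leq_addr d' p') pm')
    (leq_trans (leq_addr (~~ d') q') qn').
have level : p1 + q1 = k /\ p2 + q2 = k.
  move: pqk pqk'; rewrite pE qE pE' qE' !step_level.
  by move=> [->] [->].
have [pE1 qE1] := IHk d1 d2 p1 q1 p2 q2 pm1 qn1 pm2 qn2 sM1 sM2 level.
rewrite -pE1 -qE1 in pm2 qn2 sM2 pE' qE'.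
by rewrite pE qE pE' qE' (same_source _ _ _ _ pm1 qn1 pm2 qn2 sM1 sM2).
Qed.

(** By [step_level_inj] no other step leaves this level, so every other point of the level is
    avoided. *)
Lemma rung_beside_source (d : bool) (p q p' q' : nat) :
  p + d <= m -> q + ~~ d <= n -> step d p q \in M ->
  p' <= m -> q' <= n -> 0 < p' + q' -> p' + q' = p + q -> p' != p ->
  rung p' q' \in M.
Proof.
move=> pm qn sM pm' qn' pq0 level pp'.
have pq1 : p' + q' < m + n.
  by rewrite level -(step_level d) leq_add.
case: (cover_yv pm' qn' pq1) => [[]//|[d' [pd' qd' sM']]].
have [_ pE _] := step_level_inj pd' qd' pm qn sM' sM level.
by rewrite pE eqxx in pp'.
Qed.

(** Entering another point of the target level would take a second step out of the source level. *)
Lemma rung_beside_target (d : bool) (p q p' q' : nat) :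
  p + d <= m -> q + ~~ d <= n -> step d p q \in M ->
  p' <= m -> q' <= n -> p' + q' = (p + q).+1 -> p' != p + d ->
  rung p' q' \in M.
Proof.
move=> pm qn sM pm' qn' level pp'.
have pq0 : 0 < p' + q' by rewrite level.
case: (cover_xv pm' qn' pq0) => [[]//|[d' [p1 [q1 [pE qE sM']]]]].
rewrite pE qE step_level in pp' level pm' qn'.
case: level => level.
have [dE pE1 _] := step_level_inj pm' qn' pm qn sM' sM level.
by rewrite dE pE1 eqxx in pp'.
Qed.

(** A point of the left side can be entered only from its predecessor on that side, so avoidance
    propagates along it. *)
Lemma rung_left_side (q q' : nat) :
  0 < q -> q <= q' <= n -> rung 0 q \in M -> rung 0 q' \in M.
Proof.
move=> q0 /andP[]; elim: q' => [|q' IHq']; first by rewrite leqn0 => /eqP->.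
rewrite leq_eqVlt => /orP[/eqP->//|qq'] qn rM.
have {}rM := IHq' qq' (ltnW qn) rM.
case: (@cover_xv 0 q'.+1) => // [[]//|[d [p1 [q1 [pE qE sM]]]]].
have [p10 d0] : p1 = 0 /\ d = false by case: (d) pE; lia.
have q1E : q1 = q' by rewrite d0 in qE; lia.
rewrite p10 d0 q1E in sM.
by case: (@rung_step_source false 0 q'); rewrite ?addn0 ?addn1//; lia.
Qed.

Lemma rung_bottom_side (p p' : nat) :
  0 < p -> p <= p' <= m -> rung p 0 \in M -> rung p' 0 \in M.
Proof.
move=> p0 /andP[]; elim: p' => [|p' IHp']; first by rewrite leqn0 => /eqP->.
rewrite leq_eqVlt => /orP[/eqP->//|pp'] pm rM.
have {}rM := IHp' pp' (ltnW pm) rM.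
case: (@cover_xv p'.+1 0) => // [[]//|[d [p1 [q1 [pE qE sM]]]]].
have [q10 d0] : q1 = 0 /\ d = true by case: (d) qE; lia.
have p1E : p1 = p' by rewrite d0 in pE; lia.
rewrite q10 d0 p1E in sM.
by case: (@rung_step_source true p' 0); rewrite ?addn0 ?addn1//; lia.
Qed.

End Matching.

(** * Flips of a path across a cell *)

Lemma rung_inj (p q p' q' : nat) :
  p <= m -> q <= n -> 0 < p + q < m + n ->
  p' <= m -> q' <= n -> 0 < p' + q' < m + n ->
  rung p q = rung p' q' -> p = p' /\ q = q'.
Proof.
move=> pm qn pq pm' qn' pq' E.
have := xv_rung pm qn pq; rewrite E val_rung// !inE => /orP[]/eqP Ex.
  by apply: xv_inj Ex; lia.
by case: (@xv_neq_yv p q p' q' _ _ _ _ _ _ Ex); lia.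
Qed.

(* Going from [(p, q)] to [(p + 1, q + 1)], the path may pass through either of
   the two other corners of the square. *)
Lemma flip (M : {set edge G}) (d : bool) (p q : nat) :
  perfect_matching M -> p < m -> q < n ->
  step d p q \in M -> step (~~ d) (p + d) (q + ~~ d) \in M ->
  exists M', [/\ perfect_matching M',
    [/\ step (~~ d) p q \in M', step d (p + ~~ d) (q + d) \in M'
      & rung (p + d) (q + ~~ d) \in M'] &
    forall e, e \in M -> e <> step d p q ->
      e <> step (~~ d) (p + d) (q + ~~ d) -> e <> rung (p + ~~ d) (q + d) ->
      e \in M'].
Proof.
move=> pM pm qn sM sM'.
(* The opposite corner of the square is on the level of the corner visited, so it is avoided; its
   rung completes the alternating triple. *)
have rM : rung (p + ~~ d) (q + d) \in M.
  apply: (rung_beside_target pM _ _ sM); case: (d); lia.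
have [M' [pM' [M1 M2 M3] keep]] : exists M', [/\ perfect_matching M',
    [/\ rung (p + d) (q + ~~ d) \in M', step d (p + ~~ d) (q + d) \in M'
      & step (~~ d) p q \in M'] &
    forall e, e \in M -> e <> step d p q ->
      e <> step (~~ d) (p + d) (q + ~~ d) -> e <> rung (p + ~~ d) (q + d) ->
      e \in M'].
  apply: (@flip_hexagon G M (yv p q) (xv (p + d) (q + ~~ d))
    (yv (p + d) (q + ~~ d)) (xv p.+1 q.+1)
    (yv (p + ~~ d) (q + d)) (xv (p + ~~ d) (q + d))) => //.
  - apply: (@map_uniq _ _ val); rewrite /= ?val_xv ?val_yv; case: (d); try lia.
    + by rewrite /= !inE /xpt /ypt !xpair_eqE; lia.
    + by rewrite /= !inE /xpt /ypt !xpair_eqE; lia.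
  - by rewrite val_step//; case: (d); lia.
  - by rewrite val_rung//; case: (d); lia.
  - rewrite val_step; [|by case: (d); lia..].
    by congr [set _; xv _ _]%SET; case: (d); rewrite /= ?addn0 ?addn1.
  - rewrite val_step; [|by case: (d); lia..].
    by rewrite finset.setUC; congr [set xv _ _; _]%SET;
      case: (d); rewrite /= ?addn0 ?addn1.
  - by rewrite val_rung 1?finset.setUC//; case: (d); lia.
  - by rewrite val_step ?negbK 1?finset.setUC//; case: (d); lia.
by exists M'.
Qed.

(* The neighbour of [yv p q] in the matching of the path through [(0, n)]. *)
Definition partner (p q : nat) : nat * nat :=
  if q == n then (p.+1, n) else if p == 0 then (0, q.+1) else (p, q).

(** Vertices of the subcomplex: the bound on [p + q] discards the points of levels 1 and 2, and the
    last clause restores the apex [(1, 1)]. *)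
Definition good (p q : nat) :=
  [/\ p <= m, q <= n, 0 < p + q < m + n &
    (2 < p + q) || ((p == 1) && (q == 1))].

(** * Domination of edges by good grid points *)

Lemma dominate_rung (p q : nat) : 3 <= m -> 3 <= n ->
  p <= m -> q <= n -> 0 < p + q < m + n ->
  exists p' q', good p' q' /\ forall M, perfect_matching M ->
    rung p q \in M -> rung p' q' \in M.
Proof.
move=> m3 n3 pm qn pq.
have [gd|ngd] := boolP ((2 < p + q) || ((p == 1) && (q == 1))).
  by exists p, q; split.
have [p0|p0] := posnP p.
  (* Here [q] is 1 or 2, and [(0, 3)] is the first good point of the left side; it exists since
     [3 <= n]. *)
  exists 0, 3; split; first by split; lia.
  by move=> M pM; rewrite p0; apply: rung_left_side => //; lia.
have q0 : q = 0 by lia.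
exists 3, 0; split; first by split; lia.
by move=> M pM; rewrite q0; apply: rung_bottom_side => //; lia.
Qed.

Lemma dominate_edge (e : edge G) : 3 <= m -> 3 <= n ->
  exists p q, good p q /\ forall M, perfect_matching M ->
    e \in M -> rung p q \in M.
Proof.
move=> m3 n3; case: (edgeP e) => [[p [q [pm qn pq ->]]]|[d [p [q [pm qn ->]]]]].
  exact: dominate_rung.
suff [p' [q' [pm' qn' pq' dom]]] : exists p' q',
    [/\ p' <= m, q' <= n, 0 < p' + q' < m + n & forall M, perfect_matching M ->
    step d p q \in M -> rung p' q' \in M].
  have [p1 [q1 [gd dom1]]] := dominate_rung m3 n3 pm' qn' pq'.
  by exists p1, q1; split=> // M pM sM; apply: dom1 => //; apply: dom.
(* The dominating point lies beside the target of the step or, if the grid leaves no room there,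
   beside its source. It need not be good, whence the passage through [dominate_rung]. *)
case: d pm qn => /= pm qn.
  have [qn'|qn'] := ltnP q n.
    exists p, q.+1; split; try lia.
    by move=> M pM sM; apply: (rung_beside_target pM _ _ sM); lia.
  exists p.+1, q.-1; split; try lia.
  by move=> M pM sM; apply: (rung_beside_source pM _ _ sM); lia.
have [pm'|pm'] := ltnP p m.
  exists p.+1, q; split; try lia.
  by move=> M pM sM; apply: (rung_beside_target pM _ _ sM); lia.
exists p.-1, q.+1; split; try lia.
by move=> M pM sM; apply: (rung_beside_source pM _ _ sM); lia.
Qed.

(** * Rerouting a path away from [(1, 1)] *)

Lemma good_neq (p q p' q' : nat) : 3 <= m -> 3 <= n ->
  good p q -> p' + q' <= 2 -> p' != q' -> rung p q <> rung p' q'.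
Proof.
move=> m3 n3 [pm qn pq gd] pq' neq E.
by have [||||||? ?] := rung_inj _ _ _ _ _ _ E; lia.
Qed.

Lemma rung_neq_inner_step (d : bool) (p q p' q' : nat) : 3 <= m -> 3 <= n ->
  p <= m -> q <= n -> 0 < p + q < m + n -> p' <= 1 -> q' <= 1 ->
  rung p q <> step d p' q'.
Proof. by move=> *; apply: rung_neq_step => //; case: d; lia. Qed.

Lemma inner_step_neq (d d' : bool) (p q p' q' : nat) : 3 <= m -> 3 <= n ->
  p <= 1 -> q <= 1 -> p' <= 1 -> q' <= 1 -> p + q <> p' + q' ->
  step d p q <> step d' p' q'.
Proof.
move=> m3 n3 p1 q1 p1' q1' neq E.
suff [_ pE qE] : [/\ d = d', p = p' & q = q'] by case: neq; rewrite pE qE.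
by apply: step_inj E; [case: d|case: d|case: d'|case: d']; lia.
Qed.

(** The path turns at [(1, 1)], so one flip moves that corner to [(2, 0)] or [(0, 2)]. The only rung
    lost is at the new corner, which is not good. *)
Lemma reroute_turn (M : {set edge G}) (d : bool) : 3 <= m -> 3 <= n ->
  perfect_matching M -> step (~~ d) d (~~ d) \in M -> step d 1 1 \in M ->
  exists M', [/\ perfect_matching M', rung 1 1 \in M' &
    forall p q, good p q -> rung p q \in M -> rung p q \in M'].
Proof.
move=> m3 n3 pM sM sM'.
have [] := @flip M (~~ d) d (~~ d) pM _ _ sM _.
- by case: (d); lia.
- by case: (d); lia.
- by case: (d) sM'.
move=> M' [pM' [_ _ rM'] keep]; exists M'; split=> //.
  by case: (d) rM'.
move=> p q gd rM; apply: keep => //.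
- by case: gd => *; apply: rung_neq_inner_step => //; case: (d).
- by case: gd => *; apply: rung_neq_inner_step => //; case: (d).
- by apply: good_neq => //; case: (d).
Qed.

Lemma reroute (M : {set edge G}) : 3 <= m -> 3 <= n -> perfect_matching M ->
  exists M', [/\ perfect_matching M', rung 1 1 \in M' &
    forall p q, good p q -> rung p q \in M -> rung p q \in M'].
Proof.
move=> m3 n3 pM.
have [//|||[_ rM]|[d [pm qn sM]]] := @cover_yv M pM 1 1; try lia.
  by exists M.
have [//|||[_ rM]|[d' [p' [q' [pE qE sM']]]]] := @cover_xv M pM 1 1; try lia.
  by exists M.
have [p'E q'E] : p' = ~~ d' /\ q' = d' by case: (d') pE qE; lia.
move: sM'; rewrite {}p'E {}q'E {pE qE} => sM'.
have [dd'|/negPf dd'] := eqVneq d' (~~ d).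
  by apply: (reroute_turn m3 n3 pM _ sM); rewrite dd' negbK in sM'.
have {dd'} dE : d' = d by case: (d) (d') dd' => -[].
rewrite {}dE in sM'.
(* Now the path goes straight through [(1, 1)], coming from [(~~ d, d)]. That point is on level 1,
   so it was entered from [(0, 0)]. *)
have [|||[_ rM]|[d1 [p1 [q1 [pE qE sM1]]]]] := @cover_xv M pM (~~ d) d.
- by case: (d); lia.
- by case: (d); lia.
- by case: (d); lia.
- by case: (rung_step_source pM _ _ _ rM sM'); case: (d); lia.
have [d1E p1E q1E] : [/\ d1 = ~~ d, p1 = 0 & q1 = 0].
  by case: (d) (d1) pE qE => -[] /=; split=> //; lia.
rewrite {}d1E {}p1E {}q1E {pE qE} in sM1.
(* Flipping the first cell makes the path enter [(1, 1)] from the other side, and it then turns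
   there. The rung lost is at [(1, 0)] or [(0, 1)]. *)
have [] := @flip M (~~ d) 0 0 pM _ _ sM1 _ => //.
  by rewrite negbK !add0n.
move=> M1 [pM1 [_ sM2 _] keep].
have [||M' [pM' rM' keep']] := @reroute_turn M1 d m3 n3 pM1.
- by rewrite negbK !add0n in sM2.
- apply: keep => // E.
  + by apply: inner_step_neq E.
  + by apply: inner_step_neq E; rewrite ?leq_b1//; case: (d).
  + by apply: rung_neq_inner_step (esym E) => //; case: (d); lia.
exists M'; split=> // p q gd rM; apply: keep' => //; apply: keep => //.
- by case: gd => *; apply: rung_neq_inner_step => //; case: (d).
- by case: gd => *; apply: rung_neq_inner_step => //; case: (d).
- by apply: good_neq => //; case: (d).
Qed.

(** The map [partner] is a bijection from the grid points with a [yv] end to those with an [xv] end,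
    and its pairs are edges. *)
Lemma perfect_matching_exists : exists M : {set edge G}, perfect_matching M.
Proof.
pose nbr p q := xv (partner p q).1 (partner p q).2.
pose M : {set edge G} := [set e | `[< exists p q,
  [/\ p <= m, q <= n, p + q < m + n &
    val e = [set yv p q; nbr p q]%SET] >]]%SET.
have partnerP p q : p <= m -> q <= n -> p + q < m + n ->
    [/\ (partner p q).1 <= m, (partner p q).2 <= n &
      0 < (partner p q).1 + (partner p q).2].
  by move=> *; rewrite /partner; do ![case: eqP => ? /=]; split; lia.
have edge_ex p q : p <= m -> q <= n -> p + q < m + n ->
    exists2 e : edge G, e \in M & val e = [set yv p q; nbr p q]%SET.
  move=> pm qn pq; suff [e eE] : exists e : edge G,
      val e = [set yv p q; nbr p q]%SET.
    by exists e => //; rewrite inE; apply/asboolP; exists p, q.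
  rewrite /nbr /partner; case: eqP => [qE|qn'] /=.
    exists (step true p q); rewrite val_step; [|lia..].
    by rewrite addn1 addn0 qE.
  case: eqP => [p0|pn0] /=.
    exists (step false p q); rewrite val_step; [|lia..].
    by rewrite addn1 addn0 p0.
  by exists (rung p q); rewrite val_rung 1?finset.setUC//; lia.
exists M; apply/perfect_matchingP; split=> [e f v|v].
  rewrite !inE => -[p [q [pm qn pq eE]]] [p' [q' [pm' qn' pq' fE]]].
  suff sameE : v \in val e -> v \in val f -> p = p' /\ q = q'.
    by move=> ve vf; apply: val_inj; rewrite [LHS]eE [RHS]fE;
      case: (sameE ve vf) => -> ->.
  have [a1 a2 a3] := partnerP p q pm qn pq.
  have [b1 b2 b3] := partnerP p' q' pm' qn' pq'.
  rewrite eE fE !inE => /orP[]/eqP-> /orP[]/eqP E.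
  - exact: yv_inj E.
  - by case: (xv_neq_yv b1 b2 b3 pm qn pq (esym E)).
  - by case: (xv_neq_yv a1 a2 a3 pm' qn' pq' E).
  - move: (xv_inj a1 a2 a3 b1 b2 b3 E); rewrite /partner.
    by do ![case: eqP => ? /=]; lia.
case: (vertexP v) => [[p [q [pm qn pq ->]]]|[p [q [pm qn pq ->]]]]; last first.
  have [e eM eE] := edge_ex p q pm qn pq.
  by exists e => //; rewrite eE !inE eqxx.
(* The preimage under [partner] is the predecessor for a point on the left or top side, and the
   point itself elsewhere. *)
suff [p' [q' [pm' qn' pq' E]]] : exists p' q', [/\ p' <= m, q' <= n,
    p' + q' < m + n & partner p' q' = (p, q)].
  have [e eM eE] := edge_ex p' q' pm' qn' pq'.
  by exists e => //; rewrite eE /nbr E !inE eqxx orbT.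
rewrite /partner; have [qn'|qn'] := eqVneq q n; have [p0|p0] := posnP p.
- by exists 0, q.-1; split; try lia; rewrite ifF ?prednK ?p0//=; lia.
- by exists p.-1, n; split; try lia; rewrite eqxx prednK// qn'.
- by exists 0, q.-1; split; try lia; rewrite ifF ?prednK ?p0//=; lia.
- by exists p, q; split; try lia; rewrite !ifF//; lia.
Qed.

End Coordinates.

Theorem theorem3p11 (R : realType) (m n : nat) (hm : (3 <= m)%N) (hn : (3 <= n)%N) :
  contractible R (realization R (perfect_matching_complex (honeycomb m n))).
Proof.
have [m_gt0 n_gt0] : (0 < m)%N /\ (0 < n)%N by lia.
pose rg := rung m_gt0 n_gt0.
have dominating (e : edge (honeycomb m n)) : exists e',
    (exists p q, good m n p q /\ e' = rg p q) /\
    forall M, perfect_matching M -> e \in M -> e' \in M.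
  have [p [q [gd dom]]] := dominate_edge m_gt0 n_gt0 e hm hn.
  by exists (rg p q); split=> //; exists p, q.
(* The retraction [r] selects a dominating good rung for each edge, so any matching containing a
   face contains its image too. *)
have [r rP] := boolp.choice dominating.
have r_sub (s M : {set edge (honeycomb m n)}) : perfect_matching M ->
    s \subset M -> [set r e | e in s]%SET \subset M.
  move=> pM sM; apply/fintype.subsetP => _ /imsetP[e es ->].
  by apply: (rP e).2 => //; apply: (fintype.subsetP sM).
apply: (@contractible_realization R _ _ r (rg 1 1)) => [|s|s]; rewrite !inE.
- have [M pM] := perfect_matching_exists m_gt0 n_gt0.
  by apply/existsP; exists M; rewrite pM finset.sub0set.
- move=> /existsP[M /andP[pM sM]]; apply/existsP; exists M.
  by rewrite pM finset.subUset sM r_sub.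
move=> /existsP[M /andP[pM sM]].
(* The image of the face consists of good rungs of [M]; rerouting keeps them all and adds the
   apex. *)
have [M' [pM' rM' keep]] := reroute m_gt0 n_gt0 hm hn pM.
apply/existsP; exists M'; rewrite pM' finset.subUset finset.sub1set rM' /=.
apply/fintype.subsetP => _ /imsetP[e es ->].
have [[p [q [gd rE]]] dom] := rP e.
by rewrite rE; apply: keep => //; rewrite -/(rg p q) -rE; apply: dom => //;
  apply: (fintype.subsetP sM).
Qed.
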